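(* Consider scalar linear advection $u_t+au_x=0$ with $a>0$ in one space dimension, on a grid of background cell width $h$ with one small cut cell $j$ of volume fraction $\alpha<1/2$ (length $\alpha h$, $0<\alpha<1/2$) merged to the left with cell $j-1$, with first-order upwind flux $F(U_i,U_{i+1})=aU_i$ and CFL condition $a\,\Delta t/h\le1$. If the blending parameter of UM-SRD (update-magnitude state redistribution) is, instead of via the normalized indicator, defined via an unnormalized indicator satisfying $|s_j^n|\le C_sh^p$ for some $p\ge1$ with $C_s$ independent of $h$ and $n$, then for smooth solutions $$\|\tau^{n,\mathrm{UM}}-\tau^{n,\mathrm{base}}\|_\infty=\mathcal{O}(h^{p+1}),$$ a higher-order perturbation than the base scheme, where $\tau^{n,\mathrm{UM}}$ and $\tau^{n,\mathrm{base}}$ are the truncation errors of UM-SRD and of the base scheme. The normalized indicator is preferred in practice because it achieves exact shut-off at machine precision; the unnormalized variant provides a higher-order accuracy guarantee in smooth regions at the cost of only approximate shut-off.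
   Context: $B$ denotes one application of the base first-order upwind finite-volume scheme (in the time-step composition $U^{n+1}=R\circ B\circ P(U^n)$, with $P$ the pre-merging operator and $R$ the blended redistribution, $B$ is the finite-volume update on the merged mesh). On the neighborhood $M_j=\{j-1,j\}$, UM-SRD applies $R_j(s_j^n)=(1-s_j^n)\,\mathrm{Id}+s_j^nS_j$, with blending parameter $s_j^n\in[0,1]$, to the result of the base scheme, so that $U^{n+1,\mathrm{UM}}-U^{n+1,\mathrm{base}}=s_j^n(S_j-\mathrm{Id})U^{n+1,\mathrm{base}}$; elsewhere it acts as the identity. $S_j$ is the state redistribution (SRD) operator, which in this one-small-cell merging-left configuration satisfies $$[(S_j-\mathrm{Id})V]_{j-1}=\alpha(V_j-V_{j-1}),\qquad[(S_j-\mathrm{Id})V]_j=(1-\alpha)(V_{j-1}-V_j),$$ and $(S_j-\mathrm{Id})V=0$ at all other indices; $\mathrm{Id}$ is the identity. The truncation errors satisfy $\tau^{n,\mathrm{UM}}-\tau^{n,\mathrm{base}}=s_j^n(S_j-\mathrm{Id})B(u^n)$, where $u^n$ is the exact solution on the grid at time $t_n=n\Delta t$. The normalized indicator is $\eta_j=\Delta U_{\max,j}/(\varepsilon+\Delta U_{\max,j})$, with $\varepsilon>0$ and $\Delta U_{\max,j}=\max_{i\in M_j}\|U_i^*-U_i^n\|_2$, where $U^*$ denotes the averages after the finite-volume update of $U^n$ and before redistribution; the corresponding blending parameter is $\eta_j^q/(\eta_j^q+\tau_*^q)$ with fixed $q\ge1$, $\tau_*>0$. Shut-off means that the blending parameter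 is zero when all updates in $M_j$ vanish. *)

(* Defs.v *)
From Stdlib Require Export Reals ZArith.
From Coquelicot Require Export Coquelicot.
From Stdlib Require Import Lra.
Open Scope R_scope.

(** * Grid with one cut cell

    Cells are indexed by [Z]; those outside the domain play the role of ghost
    cells.  All cells have width [h] except cell [jcut], which has length
    [alpha * h] and left edge [xcut].  The volume fraction [alpha] stays fixed
    as the grid is refined, so it is a parameter and not a field. *)
Record grid := Grid { h : R; dt : R; jcut : Z; xcut : R }.

Definition cell_length (alpha : R) (G : grid) (i : Z) : R :=
  if Z.eqb i (jcut G) then alpha * h G else h G.

Definition cell_left (alpha : R) (G : grid) (i : Z) : R :=
  if Z.leb i (jcut G) then xcut G - IZR (jcut G - i) * h G
  else xcut G + alpha * h G + IZR (i - jcut G - 1) * h G.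

Definition cell_right (alpha : R) (G : grid) (i : Z) : R :=
  cell_left alpha G i + cell_length alpha G i.

Definition cfl_grid (a : R) (G : grid) : Prop :=
  0 < h G /\ 0 < dt G /\ a * dt G / h G <= 1.

Definition in_domain (alpha xL xR : R) (G : grid) (i : Z) : Prop :=
  xL <= cell_left alpha G i /\ cell_right alpha G i <= xR.

(** The merging neighborhood [M_j = {j-1, j}] of the cut cell. *)
Definition in_nbhd (G : grid) (i : Z) : Prop :=
  i = (jcut G - 1)%Z \/ i = jcut G.

(** The step from [n * dt] to [(n+1) * dt] takes place in [[0, T]], and the
    merging neighborhood lies in the computational domain [[xL, xR]]. *)
Definition admissible (a alpha T xL xR : R) (G : grid) (n : nat) : Prop :=
  cfl_grid a G /\ INR (S n) * dt G <= T /\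
  forall i, in_nbhd G i -> in_domain alpha xL xR G i.

(** Maximum norm over the cells of the domain. *)
Definition grid_norm (alpha xL xR : R) (G : grid) (v : Z -> R) : Rbar :=
  Lub_Rbar (fun r => exists i, in_domain alpha xL xR G i /\ r = Rabs (v i)).

(** * Smooth solutions of [u_t + a u_x = 0], with [u t x] *)
Definition smooth_solution (a T : R) (u : R -> R -> R) : Prop :=
  forall t x, 0 <= t <= T ->
    (forall k, ex_diff_n u k t x) /\
    Derive (fun t' => u t' x) t + a * Derive (u t) x = 0.

(** The exact solution on the grid at time [n * dt]: cell averages. *)
Definition exact (alpha : R) (u : R -> R -> R) (G : grid) (n : nat) (i : Z)
  : R :=
  RInt (u (INR n * dt G)) (cell_left alpha G i) (cell_right alpha G i)
  / cell_length alpha G i.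

(** * Base scheme, state redistribution, UM-SRD *)
Definition upwind_flux (a Ul Ur : R) : R := a * Ul.

Definition base_step (a alpha : R) (G : grid) (U : Z -> R) (i : Z) : R :=
  U i - dt G / cell_length alpha G i *
        (upwind_flux a (U i) (U (i + 1)%Z)
         - upwind_flux a (U (i - 1)%Z) (U i)).

Definition srd (alpha : R) (G : grid) (V : Z -> R) (i : Z) : R :=
  let j := jcut G in
  if Z.eqb i (j - 1) then V i + alpha * (V j - V (j - 1)%Z)
  else if Z.eqb i j then V i + (1 - alpha) * (V (j - 1)%Z - V j)
  else V i.

Definition redistribute (alpha : R) (G : grid) (s : R) (V : Z -> R) (i : Z)
  : R := (1 - s) * V i + s * srd alpha G V i.

(** A rule yielding [s_j^n] from the grid, the step number and the averages
    before the step (which determine those after the finite-volume update). *)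
Definition blending := grid -> nat -> (Z -> R) -> R.

Definition is_blending (s : blending) : Prop :=
  forall G n U, 0 <= s G n U <= 1.

Definition um_step (a alpha : R) (s : blending) (G : grid) (n : nat)
  (U : Z -> R) : Z -> R :=
  redistribute alpha G (s G n U) (base_step a alpha G U).

(** * Truncation errors

    One-step residuals on the exact solution, not divided by [dt]. *)
Definition trunc_base (a alpha : R) (u : R -> R -> R) (G : grid) (n : nat)
  (i : Z) : R :=
  base_step a alpha G (exact alpha u G n) i - exact alpha u G (S n) i.

Definition trunc_um (a alpha : R) (u : R -> R -> R) (s : blending) (G : grid)
  (n : nat) (i : Z) : R :=
  um_step a alpha s G n (exact alpha u G n) i - exact alpha u G (S n) i.

Definition trunc_diff (a alpha : R) (u : R -> R -> R) (s : blending)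
  (G : grid) (n : nat) (i : Z) : R :=
  trunc_um a alpha u s G n i - trunc_base a alpha u G n i.

Lemma trunc_diffE a alpha u s G n i :
  let V := base_step a alpha G (exact alpha u G n) in
  trunc_diff a alpha u s G n i
  = s G n (exact alpha u G n) * (srd alpha G V i - V i).
Proof.
  intros V; unfold trunc_diff, trunc_um, trunc_base, um_step, redistribute.
  fold V; ring.
Qed.

(** * Blending parameters *)

(** The constant [Cs] does not depend on the grid or on the step. *)
Definition unnormalized (a alpha T xL xR : R) (u : R -> R -> R) (p Cs : R)
  (s : blending) : Prop :=
  is_blending s /\
  forall G n, admissible a alpha T xL xR G n ->
    Rabs (s G n (exact alpha u G n)) <= Cs * Rpower (h G) p.

(** [x ^ q] for [x >= 0] and [q > 0]; [Rpower 0 q] is [1], not [0]. *)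
Definition pos_power (x q : R) : R :=
  if Rle_dec x 0 then 0 else Rpower x q.

Definition max_update (a alpha : R) (G : grid) (U : Z -> R) : R :=
  let d i := Rabs (base_step a alpha G U i - U i) in
  Rmax (d (jcut G - 1)%Z) (d (jcut G)).

Definition normalized_indicator (a alpha eps : R) (G : grid) (U : Z -> R)
  : R :=
  max_update a alpha G U / (eps + max_update a alpha G U).

Definition normalized_blending (a alpha eps q taustar : R) : blending :=
  fun G _ U =>
    let e := pos_power (normalized_indicator a alpha eps G U) q in
    e / (e + pos_power taustar q).

Definition exact_shut_off (a alpha : R) (s : blending) : Prop :=
  forall G n U, cfl_grid a G ->
    (forall i, in_nbhd G i -> base_step a alpha G U i = U i) ->
    s G n U = 0.

(* Main.v *)
Require Import Defs.
From Stdlib Require Import Reals ZArith.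
From Coquelicot Require Import Coquelicot.
From Stdlib Require Import Lra Lia.
Open Scope R_scope.

(** State redistribution averages the two cells of the merging neighborhood,
    so it changes [V = B(u^n)] only by multiples of the jump
    [V j - V (j - 1)]. The cell averages of a smooth solution jump by [O(h)]
    between neighbors, and one upwind step preserves this because its
    Courant number is at most [1 / alpha], even on the cut cell. Multiplying
    by a blending parameter of size [O(h ^ p)] gives a perturbation of size
    [O(h ^ (p + 1))] ([trunc_diff_le], [unnormalized_trunc_diff_le]).

    The base residual is controlled by one expansion. If [u_x] stays within
    [w] of a constant [sigma] on the space-time stencil of cell [i], the
    averages agree up to [O(w * h)] with those of an affine travelling wave of
    slope [sigma], hence ([trunc_base_expansion]) the residual is
    [a * sigma * dt * (1 - len (i - 1) / len i) / 2] up to [O(w * h)]. This is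
    used twice. With [sigma = 0] and [w] a bound for [u_x] on a compact
    rectangle containing all stencils, it gives the upper bound [O(h)]
    ([trunc_base_le]). With [sigma] the slope at the cut cell and [w] small,
    available for small [h] by uniform continuity of [u_x], it gives a lower
    bound of exact order [h] on the cut cell ([trunc_base_ge]): there
    [len (i - 1) / len i = 1 / alpha], so the leading term does not vanish.
    A perturbation of size [h ^ (p + 1) <= h ^ 2] is eventually dominated by
    it.

    Shut-off of the normalized parameter is the evaluation of its formula at
    zero updates; a parameter that ignores the state shows that the bound by
    [Cs * h ^ p] does not imply shut-off. *)

(** * Calculus *)

Lemma mean_value_affine (f : R -> R) (x0 x sigma w : R) :
  (forall y, Rmin x0 x <= y <= Rmax x0 x ->
     ex_derive f y /\ Rabs (Derive f y - sigma) <= w) ->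
  Rabs (f x - f x0 - sigma * (x - x0)) <= w * Rabs (x - x0).
Proof.
  intros H.
  destruct (MVT_gen f x0 x (Derive f)) as [c [Hc E]].
  - intros y Hy; apply Derive_correct, H; lra.
  - intros y Hy; apply continuity_pt_filterlim.
    apply (ex_derive_continuous f), H, Hy.
  - rewrite E.
    replace (Derive f c * (x - x0) - sigma * (x - x0))
      with ((Derive f c - sigma) * (x - x0)) by ring.
    rewrite Rabs_mult; apply Rmult_le_compat_r; [apply Rabs_pos|].
    now apply H.
Qed.

Lemma average_affine (f : R -> R) (l r c A B e : R) :
  l < r -> (forall x, l <= x <= r -> continuous f x) ->
  (forall x, l <= x <= r -> Rabs (f x - (A + B * (x - c))) <= e) ->
  Rabs (RInt f l r / (r - l) - (A + B * ((l + r) / 2 - c))) <= e.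
Proof.
  intros Hlr Hf He.
  set (g := fun x => A + B * (x - c)).
  assert (Hg : is_RInt g l r ((r - l) * (A + B * ((l + r) / 2 - c)))).
  { set (G := fun x => A * x + B * (x - c) ^ 2 / 2).
    replace ((r - l) * (A + B * ((l + r) / 2 - c))) with (minus (G r) (G l))
      by (unfold minus, plus, opp, G; simpl; field).
    apply (is_RInt_derive G g).
    - intros x _; unfold G, g; auto_derive; [trivial | field].
    - intros x _; unfold g.
      apply (ex_derive_continuous (fun x => A + B * (x - c))).
      auto_derive; trivial. }
  assert (Hfi : ex_RInt f l r).
  { apply (ex_RInt_continuous f); intros z Hz; apply Hf.
    rewrite Rmin_left, Rmax_right in Hz; lra. }
  assert (Hd : Rabs (RInt (fun x => minus (f x) (g x)) l r) <= (r - l) * e).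
  { apply abs_RInt_le_const; [lra | | exact He].
    apply (ex_RInt_minus f g); [assumption | eexists; exact Hg]. }
  rewrite (RInt_minus f g) in Hd; [| assumption | eexists; exact Hg].
  rewrite (is_RInt_unique _ _ _ _ Hg) in Hd.
  unfold minus, plus, opp in Hd; simpl in Hd.
  replace (RInt f l r / (r - l) - (A + B * ((l + r) / 2 - c)))
    with ((RInt f l r + - ((r - l) * (A + B * ((l + r) / 2 - c)))) / (r - l))
    by (field; lra).
  rewrite Rabs_div, (Rabs_pos_eq (r - l)) by lra.
  apply Rle_div_l; lra.
Qed.

(** Uniform continuity bounds the increments of [f] along a segment from the
    corner [(a, c)], cut into boundedly many short pieces. *)
Lemma rectangle_bounded (f : R -> R -> R) (a b c d : R) :
  (forall x y, a <= x <= b -> c <= y <= d -> continuity_2d_pt f x y) ->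
  exists L, 0 <= L /\
    forall x y, a <= x <= b -> c <= y <= d -> Rabs (f x y) <= L.
Proof.
  intros Hf.
  destruct (uniform_continuity_2d f a b c d Hf (mkposreal 1 Rlt_0_1))
    as [[delta Hd] H]; simpl in H.
  destruct (INR_unbounded ((Rabs (b - a) + Rabs (d - c)) / delta)) as [N HN].
  assert (HN0 : 0 < INR N).
  { apply Rle_lt_trans with (2 := HN).
    apply Rle_div_r; [lra|].
    pose proof (Rabs_pos (b - a)); pose proof (Rabs_pos (d - c)); lra. }
  assert (HNd : Rabs (b - a) + Rabs (d - c) < INR N * delta)
    by (apply Rlt_div_l; [lra | exact HN]).
  exists (Rabs (f a c) + INR N); split.
  { pose proof (Rabs_pos (f a c)); lra. }
  intros x y Hx Hy.
  rewrite Rabs_pos_eq in HNd by lra.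
  rewrite Rabs_pos_eq in HNd by lra.
  set (px k := a + (x - a) * (INR k / INR N)).
  set (py k := c + (y - c) * (INR k / INR N)).
  assert (Hk : forall k, (k <= N)%nat ->
    Rabs (f (px k) (py k)) <= Rabs (f a c) + INR k).
  { assert (Hin : forall k, (k <= N)%nat -> 0 <= INR k / INR N <= 1).
    { intros k Hk; apply le_INR in Hk; pose proof (pos_INR k); split.
      - apply Rle_div_r; lra.
      - apply Rle_div_l; lra. }
    assert (Hpx : forall k, (k <= N)%nat -> a <= px k <= b).
    { intros k Hk; specialize (Hin k Hk); unfold px; split; nra. }
    assert (Hpy : forall k, (k <= N)%nat -> c <= py k <= d).
    { intros k Hk; specialize (Hin k Hk); unfold py; split; nra. }
    induction k as [|k IH]; intros Hk.
    - unfold px, py; simpl INR.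
      replace (a + _) with a by (field; lra).
      replace (c + _) with c by (field; lra); lra.
    - specialize (IH ltac:(lia)).
      assert (Hstep : forall z m M, m <= z <= M -> M - m < INR N * delta ->
        Rabs (m + (z - m) * (INR (S k) / INR N)
              - (m + (z - m) * (INR k / INR N))) < delta).
      { intros z m M Hz HM; rewrite S_INR.
        replace (_ - _) with ((z - m) / INR N) by (field; lra).
        rewrite Rabs_pos_eq by (apply Rle_div_r; lra).
        apply Rlt_div_l; lra. }
      assert (Rabs (f (px (S k)) (py (S k)) - f (px k) (py k)) < 1).
      { apply H; try (apply Hpx; lia); try (apply Hpy; lia).
        - apply (Hstep x a b); lra.
        - apply (Hstep y c d); lra. }
      pose proof (Rabs_triang (f (px (S k)) (py (S k)) - f (px k) (py k))
                    (f (px k) (py k))) as Ht.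
      replace (f (px (S k)) (py (S k)) - f (px k) (py k) + f (px k) (py k))
        with (f (px (S k)) (py (S k))) in Ht by ring.
      rewrite S_INR; lra. }
  specialize (Hk N (le_n N)); unfold px, py in Hk.
  replace (INR N / INR N) with 1 in Hk by (field; lra).
  replace (a + (x - a) * 1) with x in Hk by ring.
  replace (c + (y - c) * 1) with y in Hk by ring.
  exact Hk.
Qed.

(** * Expansion of a smooth solution *)

Definition slope_within (u : R -> R -> R) (sigma w t0 t1 l r : R) : Prop :=
  forall t x, t0 <= t <= t1 -> l <= x <= r ->
    Rabs (Derive (u t) x - sigma) <= w.

Section Solution.

Variables (a T : R) (u : R -> R -> R).
Hypotheses (ha : 0 < a) (hu : smooth_solution a T u).

Lemma smooth_continuity_slope t x :
  0 <= t <= T -> continuity_2d_pt (fun t x => Derive (u t) x) t x.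
Proof.
  intros Ht; destruct (hu t x Ht) as [H _].
  exact (proj1 (proj2 (proj2 (proj2 (proj2 (H 1%nat)))))).
Qed.

Lemma smooth_ex_derive_x t x : 0 <= t <= T -> ex_derive (u t) x.
Proof.
  intros Ht; destruct (hu t x Ht) as [H _].
  exact (proj1 (proj2 (proj2 (H 1%nat)))).
Qed.

Lemma smooth_ex_derive_t t x : 0 <= t <= T -> ex_derive (fun t => u t x) t.
Proof.
  intros Ht; destruct (hu t x Ht) as [H _].
  exact (proj1 (proj2 (H 1%nat))).
Qed.

(** The equation turns the bound on [u_x - sigma] into the bound
    [a * w] on [u_t + a * sigma], so one bound controls both directions. *)
Lemma solution_expansion (sigma w t0 t1 l r x0 x : R) :
  0 <= t0 -> t0 <= t1 <= T -> l <= x0 <= r -> l <= x <= r ->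
  slope_within u sigma w t0 t1 l r ->
  Rabs (u t1 x - (u t0 x0 + sigma * (x - x0) - a * sigma * (t1 - t0)))
  <= w * (Rabs (x - x0) + a * (t1 - t0)).
Proof.
  intros Ht0 Ht1 Hx0 Hx H.
  assert (Hspace : Rabs (u t0 x - u t0 x0 - sigma * (x - x0))
                   <= w * Rabs (x - x0)).
  { apply mean_value_affine; intros y Hy.
    split; [apply smooth_ex_derive_x; lra | apply H; [lra|]].
    revert Hy; unfold Rmin, Rmax; destruct (Rle_dec x0 x); lra. }
  assert (Htime : Rabs (u t1 x - u t0 x - - (a * sigma) * (t1 - t0))
                  <= a * w * Rabs (t1 - t0)).
  { apply (mean_value_affine (fun t => u t x)); intros t Ht.
    rewrite Rmin_left, Rmax_right in Ht by lra.
    split; [apply smooth_ex_derive_t; lra|].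
    destruct (hu t x ltac:(lra)) as [_ Heq].
    replace (Derive (fun t => u t x) t - - (a * sigma))
      with (- (a * (Derive (u t) x - sigma))) by lra.
    rewrite Rabs_Ropp, Rabs_mult, (Rabs_pos_eq a) by lra.
    apply Rmult_le_compat_l; [lra | apply H; lra]. }
  rewrite (Rabs_pos_eq (t1 - t0)) in Htime by lra.
  replace (u t1 x - _)
    with ((u t0 x - u t0 x0 - sigma * (x - x0))
          + (u t1 x - u t0 x - - (a * sigma) * (t1 - t0))) by ring.
  eapply Rle_trans; [apply Rabs_triang | lra].
Qed.

(** * One step of the upwind scheme on the exact solution *)

Variable alpha : R.
Hypothesis halpha : 0 < alpha < 1 / 2.

Lemma cell_length_bounds G i :
  0 < h G -> alpha * h G <= cell_length alpha G i <= h G.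
Proof. intros Hh; unfold cell_length; destruct (Z.eqb _ _); nra. Qed.

Lemma cells_adjacent G i : cell_right alpha G (i - 1) = cell_left alpha G i.
Proof.
  unfold cell_right, cell_left, cell_length.
  destruct (Z.leb_spec (i - 1) (jcut G)); destruct (Z.leb_spec i (jcut G));
    destruct (Z.eqb_spec (i - 1) (jcut G)); try lia.
  - rewrite !minus_IZR; ring.
  - subst; replace (i - jcut G - 1)%Z with 0%Z by lia.
    replace (jcut G - (i - 1))%Z with 0%Z by lia; ring.
  - rewrite !minus_IZR; ring.
Qed.

Section Stencil.

Variables (G : grid) (n : nat) (i : Z) (sigma w : R).
Hypotheses (hG : cfl_grid a G) (hT : INR (S n) * dt G <= T).
Hypothesis hslope :
  slope_within u sigma w (INR n * dt G) (INR (S n) * dt G)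
    (cell_left alpha G i - h G) (cell_left alpha G i + h G).

Local Notation len := (cell_length alpha G).
Let xi := cell_left alpha G i.
Let A := u (INR n * dt G) xi.

Lemma step_bounds :
  0 < h G /\ 0 < dt G /\ a * dt G <= h G /\
  0 <= INR n * dt G /\ INR (S n) * dt G = INR n * dt G + dt G.
Proof using hG.
  destruct hG as (Hh & Hdt & Hc).
  apply Rle_div_l in Hc; [| lra].
  rewrite S_INR; pose proof (pos_INR n); repeat split; nra.
Qed.

Lemma slope_tolerance_ge0 : 0 <= w.
Proof using hG hslope.
  pose proof step_bounds as (Hh & Hdt & _ & Hn & HS).
  eapply Rle_trans; [apply Rabs_pos|].
  apply (hslope (INR n * dt G) (cell_left alpha G i)); lra.
Qed.

(** Affine functions have their midpoint value as cell average. *)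
Lemma average_expansion (k : Z) (m : nat) :
  m = n \/ m = S n ->
  xi - h G <= cell_left alpha G k -> cell_right alpha G k <= xi + h G ->
  Rabs (exact alpha u G m k
        - (A + sigma * (cell_left alpha G k + len k / 2 - xi)
           - a * sigma * (INR m * dt G - INR n * dt G)))
  <= w * (h G + a * (INR m * dt G - INR n * dt G)).
Proof using ha hu halpha hG hT hslope.
  intros Hm Hl Hr.
  pose proof step_bounds as (Hh & Hdt & Hc & Hn & HS).
  pose proof slope_tolerance_ge0 as Hw.
  pose proof (cell_length_bounds G k Hh) as Hlen.
  assert (Ht : INR n * dt G <= INR m * dt G <= INR (S n) * dt G)
    by (destruct Hm; subst m; lra).
  unfold exact, cell_right in *.
  set (l := cell_left alpha G k) in *; set (d := len k) in *.
  assert (Hd : 0 < d) by nra.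
  pose proof (average_affine (u (INR m * dt G)) l (l + d) xi
    (A - a * sigma * (INR m * dt G - INR n * dt G)) sigma
    (w * (h G + a * (INR m * dt G - INR n * dt G)))) as H.
  replace (l + d - l) with d in H by ring.
  replace ((l + (l + d)) / 2 - xi) with (l + d / 2 - xi) in H by field.
  replace (A + _ - a * sigma * (INR m * dt G - INR n * dt G))
    with (A - a * sigma * (INR m * dt G - INR n * dt G)
          + sigma * (l + d / 2 - xi)) by ring.
  apply H; [lra | |].
  - intros x _; apply (ex_derive_continuous (u (INR m * dt G))).
    apply smooth_ex_derive_x; lra.
  - intros x Hx.
    replace (A - _ + _)
      with (A + sigma * (x - xi) - a * sigma * (INR m * dt G - INR n * dt G))
      by ring.
    eapply Rle_trans.
    + apply (solution_expansion sigma w _ _ (xi - h G) (xi + h G)); try lra.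
      intros t y Ht' Hy; apply hslope; [lra | exact Hy].
    + apply Rmult_le_compat_l; [exact Hw|].
      apply Rplus_le_compat_r, Rabs_le; lra.
Qed.

Lemma stencil_averages :
  Rabs (exact alpha u G n i - (A + sigma * (len i / 2))) <= w * h G /\
  Rabs (exact alpha u G n (i - 1) - (A - sigma * (len (i - 1) / 2)))
    <= w * h G /\
  Rabs (exact alpha u G (S n) i
        - (A + sigma * (len i / 2) - a * sigma * dt G)) <= 2 * (w * h G).
Proof using ha hu halpha hG hT hslope.
  pose proof step_bounds as (Hh & Hdt & Hc & Hn & HS).
  pose proof slope_tolerance_ge0 as Hw.
  pose proof (cell_length_bounds G i Hh) as Hi.
  pose proof (cell_length_bounds G (i - 1) Hh) as Hi'.
  pose proof (cells_adjacent G i) as Hadj.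
  assert (Hah : 0 < alpha * h G) by nra.
  assert (Hr : cell_right alpha G i = xi + len i) by reflexivity.
  unfold cell_right in Hadj.
  repeat split.
  - pose proof (average_expansion i n (or_introl eq_refl)) as H.
    fold xi in H.
    replace (xi + len i / 2 - xi) with (len i / 2) in H by ring.
    rewrite Rminus_diag, !Rmult_0_r, Rminus_0_r, Rplus_0_r in H.
    apply H; lra.
  - pose proof (average_expansion (i - 1) n (or_introl eq_refl)) as H.
    unfold cell_right in H; rewrite Hadj in H.
    fold xi in H, Hadj.
    replace (cell_left alpha G (i - 1) + len (i - 1) / 2 - xi)
      with (- (len (i - 1) / 2)) in H by lra.
    rewrite Rminus_diag, !Rmult_0_r, Rminus_0_r, Rplus_0_r in H.
    replace (A - _) with (A + sigma * - (len (i - 1) / 2)) by ring.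
    apply H; lra.
  - pose proof (average_expansion i (S n) (or_intror eq_refl)) as H.
    fold xi in H.
    replace (xi + len i / 2 - xi) with (len i / 2) in H by ring.
    replace (INR (S n) * dt G - INR n * dt G) with (dt G) in H by lra.
    eapply Rle_trans; [apply H; lra |].
    nra.
Qed.

(** The condition [a * dt <= h] only controls the Courant number of the
    uncut cells; on the cut cell the Courant number may reach [1 / alpha]. *)
Lemma courant_bounds : 0 <= a * dt G / len i <= 1 / alpha.
Proof using ha halpha hG n.
  pose proof step_bounds as (Hh & Hdt & Hc & _).
  pose proof (cell_length_bounds G i Hh) as Hi.
  assert (Hah : 0 < alpha * h G) by nra.
  split; [apply Rle_div_r; nra|].
  apply Rle_div_l; [lra|].
  apply Rle_trans with (1 / alpha * (alpha * h G)).
  - replace (1 / alpha * (alpha * h G)) with (h G) by (field; lra); exact Hc.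
  - apply Rmult_le_compat_l; [left; apply Rdiv_lt_0_compat|]; lra.
Qed.

Lemma base_stepE :
  base_step a alpha G (exact alpha u G n) i
  = exact alpha u G n i
    - a * dt G / len i * (exact alpha u G n i - exact alpha u G n (i - 1)).
Proof using. unfold base_step, upwind_flux, Rdiv; ring. Qed.

Lemma exact_jump_le :
  sigma = 0 ->
  Rabs (exact alpha u G n i - exact alpha u G n (i - 1)) <= 2 * (w * h G).
Proof using ha hu halpha hG hT hslope.
  intros E; destruct stencil_averages as (H1 & H2 & _).
  rewrite E in H1, H2; apply Rabs_le_between in H1, H2.
  apply Rabs_le; lra.
Qed.

(** For a profile of constant slope, the values in the flux difference are
    [(len (i - 1) + len i) / 2] apart, but the scheme divides by [len i]; the
    update matches the exact decrease [a * sigma * dt] only if both lengths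
    agree. *)
Lemma trunc_base_expansion :
  Rabs (trunc_base a alpha u G n i
        - a * sigma * dt G * (1 - len (i - 1) / len i) / 2)
  <= (3 + 2 / alpha) * (w * h G).
Proof using ha hu halpha hG hT hslope.
  pose proof step_bounds as (Hh & Hdt & Hc & _).
  pose proof slope_tolerance_ge0 as Hw.
  destruct stencil_averages as (H1 & H2 & H3).
  pose proof courant_bounds as Hnu.
  pose proof (cell_length_bounds G i Hh) as Hi.
  assert (Hli : 0 < len i) by nra.
  unfold trunc_base; rewrite base_stepE.
  set (U := exact alpha u G n i) in *.
  set (U' := exact alpha u G n (i - 1)) in *.
  set (W := exact alpha u G (S n) i) in *.
  set (nu := a * dt G / len i) in *.
  set (e1 := U - _) in H1; set (e2 := U' - _) in H2; set (e3 := W - _) in H3.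
  replace (U - nu * (U - U') - W - _)
    with (e1 - e3 - nu * (e1 - e2)) by (unfold e1, e2, e3, nu; field; lra).
  assert (Hn : Rabs (nu * (e1 - e2)) <= 1 / alpha * (2 * (w * h G))).
  { rewrite Rabs_mult, (Rabs_pos_eq nu) by lra.
    apply Rmult_le_compat; [lra | apply Rabs_pos | lra |].
    apply Rabs_le_between in H1, H2; apply Rabs_le; lra. }
  apply Rabs_le_between in H1, H3, Hn.
  replace (2 / alpha) with (1 / alpha * 2) by (field; lra).
  apply Rabs_le; lra.
Qed.

End Stencil.

(** * Bounds on the domain *)

Variables xL xR : R.

(** Both cells of the merging neighborhood fit into [[xL, xR]], hence so does
    a cell width; this confines the stencils to a fixed interval. *)
Lemma admissible_width G n :
  admissible a alpha T xL xR G n -> 0 < h G <= xR - xL.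
Proof.
  intros ((Hh & _) & _ & Hd).
  destruct (Hd (jcut G - 1)%Z) as [H1 _]; [now left|].
  destruct (Hd (jcut G)) as [_ H2]; [now right|].
  pose proof (cells_adjacent G (jcut G)) as H.
  pose proof (cell_length_bounds G (jcut G) Hh) as Hl.
  unfold cell_right in H, H2.
  assert (E : cell_length alpha G (jcut G - 1) = h G).
  { unfold cell_length; destruct (Z.eqb_spec (jcut G - 1) (jcut G)); [lia|].
    reflexivity. }
  rewrite E in H; nra.
Qed.

Lemma stencil_in_interval G n i :
  admissible a alpha T xL xR G n -> in_domain alpha xL xR G i ->
  xL - (xR - xL) <= cell_left alpha G i - h G /\
  cell_left alpha G i + h G <= xR + (xR - xL).
Proof.
  intros HG [H1 H2]; pose proof (admissible_width G n HG) as Hh.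
  pose proof (cell_length_bounds G i (proj1 Hh)) as Hl.
  unfold cell_right in H2; nra.
Qed.

Lemma slope_bounded :
  exists L, 0 <= L /\
    forall G n i, admissible a alpha T xL xR G n ->
    in_domain alpha xL xR G i ->
    slope_within u 0 L (INR n * dt G) (INR (S n) * dt G)
      (cell_left alpha G i - h G) (cell_left alpha G i + h G).
Proof using ha hu halpha.
  destruct (rectangle_bounded (fun t x => Derive (u t) x) 0 T
    (xL - (xR - xL)) (xR + (xR - xL))) as [L [HL H]].
  { intros t x Ht _; now apply smooth_continuity_slope. }
  exists L; split; [exact HL|].
  intros G n i HG Hi t x Ht Hx.
  pose proof (stencil_in_interval G n i HG Hi) as Hs.
  pose proof (step_bounds G n (proj1 HG)) as (_ & _ & _ & Hn & _).
  destruct HG as (_ & HT & _).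
  rewrite Rminus_0_r; apply H; lra.
Qed.

Lemma trunc_base_le :
  exists C, forall G n i, admissible a alpha T xL xR G n ->
    in_domain alpha xL xR G i -> Rabs (trunc_base a alpha u G n i) <= C * h G.
Proof using ha hu halpha.
  destruct slope_bounded as [L [_ HL]].
  exists ((3 + 2 / alpha) * L); intros G n i HG Hi.
  pose proof (trunc_base_expansion G n i 0 L (proj1 HG) (proj1 (proj2 HG))
    (HL G n i HG Hi)) as H.
  replace (trunc_base _ _ _ _ _ _ - _)
    with (trunc_base a alpha u G n i) in H by (unfold Rdiv; ring).
  lra.
Qed.

(** One power of [h] comes from the jump of [B(u^n)] across the merged pair,
    the others from the blending parameter. *)
Lemma trunc_diff_le :
  exists K, 0 <= K /\ forall s G n i, admissible a alpha T xL xR G n ->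
    Rabs (trunc_diff a alpha u s G n i)
    <= Rabs (s G n (exact alpha u G n)) * (K * h G).
Proof using ha hu halpha.
  destruct slope_bounded as [L [HL0 HL]].
  assert (Hia : 0 < 1 / alpha) by (apply Rdiv_lt_0_compat; lra).
  exists (2 * L * (1 + 2 * (1 / alpha))); split.
  { apply Rmult_le_pos; lra. }
  intros s G n i HG; rewrite trunc_diffE, Rabs_mult.
  apply Rmult_le_compat_l; [apply Rabs_pos|].
  set (V := base_step a alpha G (exact alpha u G n)).
  pose proof (admissible_width G n HG) as Hh.
  assert (HLh : 0 <= L * h G) by nra.
  assert (HV : Rabs (V (jcut G) - V (jcut G - 1)%Z)
               <= 2 * L * (1 + 2 * (1 / alpha)) * h G).
  { assert (Hjump : forall k, in_nbhd G k ->
      Rabs (exact alpha u G n k - exact alpha u G n (k - 1)) <= 2 * (L * h G)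
      /\ Rabs (a * dt G / cell_length alpha G k
               * (exact alpha u G n k - exact alpha u G n (k - 1)))
         <= 1 / alpha * (2 * (L * h G))).
    { intros k Hk; pose proof HG as (Hc & HT & Hd).
      pose proof (exact_jump_le G n k 0 L Hc HT (HL G n k HG (Hd k Hk))
                    eq_refl) as Hj.
      split; [exact Hj|].
      pose proof (courant_bounds G n k Hc) as Hnu.
      rewrite Rabs_mult, (Rabs_pos_eq (a * dt G / _)) by lra.
      apply Rmult_le_compat; [lra | apply Rabs_pos | lra | exact Hj]. }
    destruct (Hjump (jcut G) (or_intror eq_refl)) as [Hj1 Hj2].
    destruct (Hjump (jcut G - 1)%Z (or_introl eq_refl)) as [_ Hj3].
    unfold V; rewrite !base_stepE.
    apply Rabs_le_between in Hj1, Hj2, Hj3; apply Rabs_le; lra. }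
  apply Rle_trans with (2 := HV).
  unfold srd; destruct (Z.eqb_spec i (jcut G - 1)) as [E1|E1];
    [| destruct (Z.eqb_spec i (jcut G)) as [E2|E2]].
  - rewrite E1.
    replace (_ + _ - _) with (alpha * (V (jcut G) - V (jcut G - 1)%Z)) by ring.
    rewrite Rabs_mult, (Rabs_pos_eq alpha) by lra.
    pose proof (Rabs_pos (V (jcut G) - V (jcut G - 1)%Z)); nra.
  - rewrite E2.
    replace (_ + _ - _)
      with (- ((1 - alpha) * (V (jcut G) - V (jcut G - 1)%Z))) by ring.
    rewrite Rabs_Ropp, Rabs_mult, (Rabs_pos_eq (1 - alpha)) by lra.
    pose proof (Rabs_pos (V (jcut G) - V (jcut G - 1)%Z)); nra.
  - rewrite Rminus_diag, Rabs_R0; apply Rabs_pos.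
Qed.

Lemma unnormalized_trunc_diff_le p Cs :
  exists K, 0 <= K /\ forall s G n i,
    unnormalized a alpha T xL xR u p Cs s ->
    admissible a alpha T xL xR G n ->
    Rabs (trunc_diff a alpha u s G n i) <= K * Rpower (h G) (p + 1).
Proof using ha hu halpha.
  destruct trunc_diff_le as [K [HK H]].
  exists (Rabs Cs * K); split; [apply Rmult_le_pos; [apply Rabs_pos | lra]|].
  intros s G n i [_ Hs] HG.
  pose proof (admissible_width G n HG) as Hh.
  specialize (Hs G n HG).
  eapply Rle_trans; [apply (H s G n i HG)|].
  rewrite Rpower_plus, Rpower_1 by lra.
  replace (Rabs Cs * K * (Rpower (h G) p * h G))
    with (Rabs Cs * Rpower (h G) p * (K * h G)) by ring.
  apply Rmult_le_compat_r; [nra|].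
  eapply Rle_trans; [exact Hs|].
  apply Rmult_le_compat_r; [left; apply exp_pos | apply Rle_abs].
Qed.

(** On the cut cell the leading term of the expansion is
    [a * sigma * dt * (1 - 1 / alpha) / 2], which does not vanish since
    [alpha < 1]. Once [u_x] is nearly constant on the stencil, the remainder
    takes away at most half of it. *)
Lemma trunc_base_ge lam m :
  0 < lam -> 0 < m ->
  exists c h0, 0 < c /\ 0 < h0 /\
    forall G n, admissible a alpha T xL xR G n ->
    h G <= h0 -> lam <= a * dt G / h G ->
    m <= Rabs (Derive (u (INR n * dt G)) (xcut G)) ->
    c * h G <= Rabs (trunc_base a alpha u G n (jcut G)).
Proof using ha hu halpha.
  intros Hlam Hm.
  assert (Hia : 2 < 1 / alpha) by (apply Rlt_div_r; lra).
  set (kappa := lam * m * (1 / alpha - 1) / 2).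
  assert (Hk : 0 < kappa).
  { unfold kappa; assert (0 < lam * m) by nra; nra. }
  (* the remainder of the expansion is then at most kappa * h / 2 *)
  set (w := kappa / 2 / (3 + 2 / alpha)).
  assert (Hden : 0 < 3 + 2 / alpha).
  { replace (2 / alpha) with (2 * (1 / alpha)) by (field; lra); lra. }
  assert (Hw : 0 < w).
  { unfold w; apply Rdiv_lt_0_compat; lra. }
  destruct (uniform_continuity_2d (fun t x => Derive (u t) x) 0 T
    (xL - (xR - xL)) (xR + (xR - xL)))
    with (eps := mkposreal w Hw) as [[delta Hd] Hunif].
  { intros t x Ht _; now apply smooth_continuity_slope. }
  simpl in Hunif.
  exists (kappa / 2), (Rmin (delta / 2) (a * delta / 2)).
  assert (Had : 0 < a * delta) by nra.
  split; [lra|]; split; [apply Rmin_pos; lra|].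
  intros G n HG Hh0 Hlamh Hslope.
  pose proof (Rmin_l (delta / 2) (a * delta / 2)).
  pose proof (Rmin_r (delta / 2) (a * delta / 2)).
  pose proof HG as (Hc & HT & Hdom).
  pose proof (step_bounds G n Hc) as (Hh & Hdt & Hcfl & Hn & HS).
  assert (Hj : in_domain alpha xL xR G (jcut G)) by (apply Hdom; now right).
  pose proof (stencil_in_interval G n (jcut G) HG Hj) as Hs.
  assert (Hxc : cell_left alpha G (jcut G) = xcut G).
  { unfold cell_left; rewrite Z.leb_refl, Z.sub_diag; ring. }
  assert (Hdtd : dt G < delta) by nra.
  set (sigma := Derive (u (INR n * dt G)) (xcut G)) in *.
  assert (Hw' : slope_within u sigma w (INR n * dt G) (INR (S n) * dt G)
    (cell_left alpha G (jcut G) - h G) (cell_left alpha G (jcut G) + h G)).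
  { rewrite Hxc in *; intros t x Ht Hx; left; apply Hunif; try lra;
      apply Rabs_def1; lra. }
  pose proof (trunc_base_expansion G n (jcut G) sigma w Hc HT Hw') as H1.
  assert (Hl1 : cell_length alpha G (jcut G - 1) = h G).
  { unfold cell_length; destruct (Z.eqb_spec (jcut G - 1) (jcut G)); [lia|].
    reflexivity. }
  assert (Hl2 : cell_length alpha G (jcut G) = alpha * h G).
  { unfold cell_length; now rewrite Z.eqb_refl. }
  rewrite Hl1, Hl2 in H1.
  replace ((3 + 2 / alpha) * (w * h G)) with (kappa / 2 * h G) in H1
    by (unfold w; field; split; lra).
  set (lead := a * sigma * dt G * _ / 2) in H1.
  assert (Hlead : kappa * h G <= Rabs lead).
  { replace lead with (- (sigma * (a * dt G * ((1 / alpha - 1) / 2))))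
      by (unfold lead; field; split; lra).
    apply Rle_div_r in Hlamh; [| lra].
    assert (0 < lam * h G) by nra.
    rewrite Rabs_Ropp, Rabs_mult,
      (Rabs_pos_eq (a * dt G * _)) by (apply Rmult_le_pos; lra).
    replace (kappa * h G) with (m * (lam * h G * ((1 / alpha - 1) / 2)))
      by (unfold kappa; field; lra).
    apply Rmult_le_compat; [lra | apply Rmult_le_pos; lra | exact Hslope |].
    apply Rmult_le_compat_r; lra. }
  pose proof (Rabs_triang_inv lead (lead - trunc_base a alpha u G n (jcut G)))
    as Ht.
  replace (lead - (lead - trunc_base a alpha u G n (jcut G)))
    with (trunc_base a alpha u G n (jcut G)) in Ht by ring.
  rewrite (Rabs_minus_sym lead) in Ht; lra.
Qed.

End Solution.

Lemma grid_norm_le alpha xL xR G v (C : R) :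
  (forall i, in_domain alpha xL xR G i -> Rabs (v i) <= C) ->
  Rbar_le (grid_norm alpha xL xR G v) C.
Proof.
  intros H; unfold grid_norm; apply Lub_Rbar_correct.
  intros r [i [Hi ->]]; exact (H i Hi).
Qed.

Lemma grid_norm_ge alpha xL xR G v i :
  in_domain alpha xL xR G i ->
  Rbar_le (Rabs (v i)) (grid_norm alpha xL xR G v).
Proof.
  intros H; unfold grid_norm; apply Lub_Rbar_correct.
  now exists i.
Qed.

Lemma Rbar_mult_ge (eps c : R) (N : Rbar) :
  0 < eps -> Rbar_le c N -> Rbar_le (eps * c) (Rbar_mult eps N).
Proof.
  intros He; destruct N as [r| |]; simpl; [| |easy].
  - intros H; apply Rmult_le_compat_l; lra.
  - intros _; unfold Rbar_mult; simpl.
    destruct (Rle_dec 0 eps) as [H|H]; [|lra].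
    destruct (Rle_lt_or_eq_dec 0 eps H); [exact I | lra].
Qed.

Lemma Rpower_le_base x p : 0 < x <= 1 -> 1 <= p -> Rpower x p <= x.
Proof.
  intros Hx Hp; rewrite <- (Rpower_1 x) at 2 by lra.
  unfold Rpower; assert (ln x <= 0).
  { rewrite <- ln_1; apply ln_le; lra. }
  apply Rnot_lt_le; intros Hlt; apply exp_lt_inv in Hlt; nra.
Qed.

(** * Shut-off *)

Lemma normalized_blending_shut_off a alpha eps q taustar :
  exact_shut_off a alpha (normalized_blending a alpha eps q taustar).
Proof.
  intros G n U _ H.
  assert (E : max_update a alpha G U = 0).
  { unfold max_update; rewrite !H by (unfold in_nbhd; auto).
    rewrite !Rminus_diag, Rabs_R0; apply Rmax_left; lra. }
  unfold normalized_blending, normalized_indicator; rewrite E.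
  unfold Rdiv; rewrite Rmult_0_l; unfold pos_power at 1.
  destruct (Rle_dec 0 0); [apply Rmult_0_l | lra].
Qed.

(** The bound leaves room for a parameter that ignores the state and equals
    [Cs * h ^ p], capped at [1]; a vanishing state has no updates at all. *)
Lemma unnormalized_without_shut_off a alpha T xL xR u p Cs :
  0 < a -> 0 < Cs ->
  exists s, unnormalized a alpha T xL xR u p Cs s /\ ~ exact_shut_off a alpha s.
Proof.
  intros Ha HC.
  set (s := (fun G _ _ => Rmin 1 (Cs * Rpower (h G) p)) : blending).
  assert (Hpos : forall G n U, 0 < s G n U).
  { intros G n U; apply Rmin_pos; [lra|].
    apply Rmult_lt_0_compat; [exact HC | apply exp_pos]. }
  exists s; split; [split|].
  - intros G n U; split; [left; apply Hpos | apply Rmin_l].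
  - intros G n _; rewrite Rabs_pos_eq by (left; apply Hpos); apply Rmin_r.
  - intros H; set (G := Grid 1 (/ a) 0%Z 0).
    specialize (Hpos G 0%nat (fun _ => 0)).
    rewrite H in Hpos; [lra | |].
    + unfold cfl_grid, G; simpl; repeat split; [lra | |].
      * now apply Rinv_0_lt_compat.
      * right; field; lra.
    + intros i _; unfold base_step, upwind_flux; ring.
Qed.

Theorem mainTheorem4 (a alpha T xL xR : R) (u : R -> R -> R) (p Cs : R)
  (ha : 0 < a) (halpha : 0 < alpha < 1 / 2)
  (hu : smooth_solution a T u) (hp : 1 <= p) :
  (* the perturbation is O(h^(p+1)) *)
  (exists C : R, forall s : blending,
     unnormalized a alpha T xL xR u p Cs s ->
     forall (G : grid) (n : nat), admissible a alpha T xL xR G n ->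
     Rbar_le (grid_norm alpha xL xR G (trunc_diff a alpha u s G n))
             (Finite (C * Rpower (h G) (p + 1))))
  /\
  (* it is of higher order than the truncation error of the base scheme,
     which is O(h) ... *)
  (exists C : R, forall (G : grid) (n : nat),
     admissible a alpha T xL xR G n ->
     Rbar_le (grid_norm alpha xL xR G (trunc_base a alpha u G n))
             (Finite (C * h G)))
  /\
  (* ... and dominates it when the Courant number and the slope at the cut
     cell are bounded away from zero *)
  (forall lam m eps : R, 0 < lam -> 0 < m -> 0 < eps ->
     exists h0 : R, 0 < h0 /\
     forall s : blending, unnormalized a alpha T xL xR u p Cs s ->
     forall (G : grid) (n : nat), admissible a alpha T xL xR G n ->
     h G <= h0 -> lam <= a * dt G / h G ->
     m <= Rabs (Derive (u (INR n * dt G)) (xcut G)) ->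
     Rbar_le (grid_norm alpha xL xR G (trunc_diff a alpha u s G n))
             (Rbar_mult (Finite eps)
                (grid_norm alpha xL xR G (trunc_base a alpha u G n))))
  /\
  (* the normalized indicator shuts off exactly *)
  (forall eps q taustar : R, 0 < eps -> 1 <= q -> 0 < taustar ->
     exact_shut_off a alpha (normalized_blending a alpha eps q taustar))
  /\
  (* the bound on the unnormalized variant does not ensure exact shut-off *)
  (0 < Cs -> exists s : blending,
     unnormalized a alpha T xL xR u p Cs s /\ ~ exact_shut_off a alpha s).
Proof.
  destruct (unnormalized_trunc_diff_le a T u ha hu alpha halpha xL xR p Cs)
    as [K [HK Hdiff]].
  split; [|split; [|split; [|split]]].
  - exists K; intros s Hs G n HG; apply grid_norm_le; intros i _.
    now apply Hdiff.
  - destruct (trunc_base_le a T u ha hu alpha halpha xL xR) as [C HC].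
    exists C; intros G n HG; apply grid_norm_le; intros i Hi.
    now apply HC.
  - intros lam m eps Hlam Hm Heps.
    destruct (trunc_base_ge a T u ha hu alpha halpha xL xR lam m Hlam Hm)
      as (c & h0 & Hc & Hh0 & Hbase).
    (* for h <= 1 and K * h <= eps * c: K h^(p+1) <= K h^2 <= eps * c * h *)
    set (h1 := eps * c / (K + 1)).
    assert (Hec : 0 < eps * c) by nra.
    assert (Hh1 : 0 < h1) by (apply Rdiv_lt_0_compat; lra).
    exists (Rmin h0 (Rmin 1 h1)); split.
    { repeat apply Rmin_pos; lra. }
    intros s Hs G n HG Hh Hl Hsl.
    pose proof (Rmin_l h0 (Rmin 1 h1)); pose proof (Rmin_r h0 (Rmin 1 h1)).
    pose proof (Rmin_l 1 h1); pose proof (Rmin_r 1 h1).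
    assert (HhG : 0 < h G) by apply HG.
    apply Rbar_le_trans with (eps * (c * h G)).
    + apply grid_norm_le; intros i _.
      eapply Rle_trans; [now apply Hdiff|].
      rewrite Rpower_plus, Rpower_1 by lra.
      pose proof (Rpower_le_base (h G) p ltac:(lra) hp) as Hp.
      assert (Hle : h G * (K + 1) <= eps * c)
        by (apply Rle_div_r; [lra | unfold h1 in *; lra]).
      replace (K * (Rpower (h G) p * h G)) with (K * Rpower (h G) p * h G)
        by ring.
      rewrite <- Rmult_assoc; apply Rmult_le_compat_r; nra.
    + apply Rbar_mult_ge; [exact Heps|].
      apply Rbar_le_trans with (2 := grid_norm_ge alpha xL xR G _ (jcut G)
        (proj2 (proj2 HG) _ (or_intror eq_refl))).
      apply Hbase; try assumption; lra.
  - intros eps q taustar _ _ _; apply normalized_blending_shut_off.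
  - intros HC; now apply unnormalized_without_shut_off.
Qed.
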